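(* Assume that the noise is Gaussian, $\epsilon\sim \mathsf{N}(0,I_n)$. There exist positive numerical constants $c$ and $n_0$ such that for all $\kappa\in(0,2/3)$, all $n\geq n_0$, and any test $\mathscr{T}$ of $(H_0)\ \{\theta\in\Theta_0\}$ versus $(H_1)\ \{\theta\in\Theta_1\}$, one has $$\sup_{\theta\in \Theta_0}\mathbb{P}_{\theta}[\mathscr{T}=1] + \sup_{\theta\in \Theta_1,\ E_1(\theta)\geq \sqrt{2(1-\kappa)(1-n^{-1/2})\log \log (n)}}\mathbb{P}_{\theta}[\mathscr{T}=0]\geq 1- c \left(\log (n)\right)^{-\frac{\kappa^2}{8(1-\kappa)}}.$$
   Context: Model: one observes $Y=(Y_1,\dots,Y_n)$ with $Y_i=\theta_i+\epsilon_i$, $\theta\in\mathbb{R}^n$ unknown; $\mathbb{P}_\theta$ is the distribution of $Y$. $\Theta_0\subset\mathbb{R}^n$ is the set of constant vectors. $\Theta_1\subset\mathbb{R}^n$ is the set of vectors with exactly one change-point, i.e. such that there are an integer $\tau^*\in\{2,\dots,n\}$ and reals $\mu_1\neq\mu_2$ with $\theta_i=\mu_1$ for $i<\tau^*$ and $\theta_i=\mu_2$ for $i\geq\tau^*$; put $\Delta=\mu_2-\mu_1$. The energy of $\theta\in\Theta_1$ is $E_1(\theta)=|\Delta|\sqrt{(\tau^*-1)(n+1-\tau^* )/n}$. A test is a $\{0,1\}$-valued measurable function of $Y$. $\log$ is the natural logarithm. *)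

(* Defs.v *)
From HB Require Import structures.
From mathcomp Require Import all_boot all_order all_algebra.
From mathcomp Require Import all_classical all_reals all_analysis.
From mathcomp Require Import measurable_realfun.

Set Implicit Arguments.
Unset Strict Implicit.
Unset Printing Implicit Defensive.

Import Order.TTheory GRing.Theory Num.Theory.
Import numFieldNormedType.Exports.

Local Open Scope classical_set_scope.
Local Open Scope ring_scope.

Section gaussian_vector.
Context {R : realType}.

(* normal_prob is a measure on measurableTypeR R, which is R with the same
   Borel sigma-algebra as the canonical one but another display. *)
Definition consV (n : nat) (x : measurableTypeR R * n.-tuple R) :
    n.+1.-tuple R :=
  [tuple of (x.1 : R) :: x.2].

Lemma measurable_consV (n : nat) :
  measurable_fun [set: measurableTypeR R * n.-tuple R] (@consV n).
Proof.
apply: (@measurable_cons _ _ _ R (fun x => x.1 : R)) => //.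
exact: (@measurable_fst _ _ (measurableTypeR R) (n.-tuple R)).
Qed.

HB.instance Definition _ (n : nat) :=
  isMeasurableFun.Build _ _ _ _ (@consV n) (@measurable_consV n).

(* N(0, I_n), as the n-fold product of N(0, 1) transported to n-tuples. *)
Fixpoint std_normal (n : nat) : probability (n.-tuple R) R :=
  match n with
  | 0 => dirac [tuple]
  | n'.+1 => distribution (normal_prob 0 1 \x std_normal n')%E (@consV n')
  end.

Lemma std_normal_box (n : nat) (A : 'I_n -> set R) :
  (forall i, measurable (A i)) ->
  std_normal n [set y | forall i, A i (tnth y i)] =
  (\prod_(i < n) normal_prob 0 1 (A i))%E.
Proof.
elim: n A => [|n IH] A mA.
  by rewrite big_ord0 /= diracE mem_set// => -[].
rewrite big_ord_recl -IH//.
rewrite -product_measure1E//; last 2 first.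
- exact: mA.
- rewrite (_ : [set _ | _] =
      \big[setI/setT]_(i < n) ((fun y => tnth y i) @^-1` A (lift ord0 i))).
    apply: bigsetI_measurable => i _; rewrite -[X in measurable X]setTI.
    exact: measurable_tnth.
  rewrite -bigcap_seq; apply/seteqP; split => [y /= Ay i _|y /= Ay i].
    exact: Ay.
  by apply: (Ay i) => /=; rewrite mem_index_enum.
rewrite /= /distribution /pushforward; apply: congr1.
apply/seteqP; split => [[x y] /= Axy|[x y] /= [Ax Ay] i].
  split=> [|i /=]; first exact: Axy ord0.
  by have := Axy (lift ord0 i); rewrite /consV tnthS.
by case: (unliftP ord0 i) => [j|] ->; rewrite /consV ?tnthS.
Qed.

Definition addV (n : nat) (theta eps : n.-tuple R) : n.-tuple R :=
  [tuple tnth theta i + tnth eps i | i < n].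

Lemma measurable_addV (n : nat) (theta : n.-tuple R) :
  measurable_fun [set: n.-tuple R] (addV theta).
Proof.
apply/measurable_fun_tnthP => i.
rewrite (_ : _ \o _ = fun y => tnth theta i + tnth y i).
  by apply: measurable_funD => //; exact: measurable_tnth.
by apply/funext => y /=; rewrite tnth_mktuple.
Qed.

HB.instance Definition _ (n : nat) (theta : n.-tuple R) :=
  isMeasurableFun.Build _ _ _ _ (addV theta) (measurable_addV theta).

Definition law (n : nat) (theta : n.-tuple R) : probability (n.-tuple R) R :=
  distribution (std_normal n) (addV theta).

End gaussian_vector.

Section change_point.
Context {R : realType}.

Definition Theta0 (n : nat) : set (n.-tuple R) :=
  [set theta | exists mu : R, forall i : 'I_n, tnth theta i = mu].

(* Coordinates are numbered from 1 in the definition of tau, so that the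
   coordinate stored at the ordinal i has number i.+1. *)
Definition is_change_point (n : nat) (theta : n.-tuple R) (tau : nat)
    (mu1 mu2 : R) : Prop :=
  [/\ (2 <= tau <= n)%N, mu1 != mu2 &
      forall i : 'I_n, tnth theta i = if (i.+1 < tau)%N then mu1 else mu2].

Definition Theta1 (n : nat) : set (n.-tuple R) :=
  [set theta | exists tau mu1 mu2, is_change_point theta tau mu1 mu2].

Definition energy (n tau : nat) (Delta : R) : R :=
  `|Delta| * Num.sqrt (((tau - 1) * (n + 1 - tau))%:R / n%:R).

(* Well-defined on Theta1 since (tau, mu1, mu2) is determined by theta (see E1E
   below); the value outside Theta1 is irrelevant. *)
Definition E1 (n : nat) (theta : n.-tuple R) : R :=
  get [set e | exists tau mu1 mu2,
    is_change_point theta tau mu1 mu2 /\ e = energy n tau (mu2 - mu1)].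

Lemma is_change_point_inj (n : nat) (theta : n.-tuple R) t m1 m2 t' m1' m2' :
  is_change_point theta t m1 m2 -> is_change_point theta t' m1' m2' ->
  [/\ t = t', m1 = m1' & m2 = m2'].
Proof.
move=> [/andP[t2 tn] m12 tm] [/andP[t2' tn'] m12' tm'].
have n0 : (0 < n)%N by apply: leq_trans tn; exact: ltnW.
have nn : (n.-1 < n)%N by rewrite prednK.
have em1 : m1 = m1'.
  by have := tm (Ordinal n0); rewrite tm' /= t2 t2'.
have em2 : m2 = m2'.
  by have := tm (Ordinal nn); rewrite tm' /= prednK// ltnNge tn' ltnNge tn.
subst m1' m2'; split => //.
wlog tt : t t' t2 tn t2' tn' tm tm' / (t < t')%N.
  move=> W; case: (ltngtP t t') => // h; first exact: W h.
  by apply/esym; exact: W h.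
have t0 : (0 < t)%N by exact: ltnW.
have ht : (t.-1 < n)%N by rewrite prednK.
have := tm (Ordinal ht); rewrite tm' /= prednK// ltnn tt => /eqP.
by rewrite (negbTE m12).
Qed.

Lemma E1E (n : nat) (theta : n.-tuple R) tau mu1 mu2 :
  is_change_point theta tau mu1 mu2 -> E1 theta = energy n tau (mu2 - mu1).
Proof.
move=> h; rewrite /E1; apply: get_unique; first by exists tau, mu1, mu2.
move=> e [t [m1 [m2 [h' ->]]]].
by have [-> -> ->] := is_change_point_inj h h'.
Qed.

End change_point.

(* Main.v *)
Require Import Defs.
From HB Require Import structures.
From mathcomp Require Import all_boot all_order all_algebra.
From mathcomp Require Import all_classical all_reals all_analysis.
From mathcomp Require Import measurable_realfun ring lra.

Set Implicit Arguments.
Unset Strict Implicit.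
Unset Printing Implicit Defensive.

Import Order.TTheory GRing.Theory Num.Theory.
Import numFieldNormedType.Exports.

Local Open Scope classical_set_scope.
Local Open Scope ring_scope.

(* Put l = log log n and r^2 = 2 (1 - kappa) l, and let p be about log n and K
   about log n / (8 l).  For k < K let theta_k be r / p^(k+1) on its first
   p^(2(k+1)) coordinates and 0 afterwards: all these vectors have norm r, energy
   above the threshold (as p^(2K) <= sqrt n), and pairwise inner products at most
   r^2 / p.  The null vector is tested against the uniform mixture of the
   theta_k, whose likelihood ratio is truncated, for each k, on the event that
   the projection of y on the restriction beta_k of theta_k to the block
   [p^(2k), p^(2(k+1))) exceeds its mean under theta_k by at most s r, with
   s^2 / 2 = kappa^2 l / (8 (1 - kappa)).

   Truncation costs a mass exp(- s^2 / 2), which is the announced rate, and makes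
   the diagonal part of the variance, of order exp(r^2/2 + r s - s^2/2) / K, at
   most of order exp(- s^2); the factor l in 1 / K is absorbed because
   r s <= 0.71 kappa l leaves a margin exp(- kappa l / 25).  As the beta_k have
   disjoint supports, the truncation events are independent, so that the
   covariances are at most exp(r^2 / p) - 1. *)

(** * Densities and translation of the normal law *)

Section density.
Context d (T : measurableType d) (R : realType).
Variables (mu nu : {measure set T -> \bar R}) (g : T -> R).
Hypotheses (mg : measurable_fun [set: T] g) (g0 : forall x, 0 <= g x).
Hypothesis nuE : forall A, measurable A -> nu A = (\int[mu]_(x in A) (g x)%:E)%E.

Import HBNNSimple.

(** Both sides are monotone limits along the simple approximations [f_] of [f]; for a simple
    function the identity reduces to [nuE] on each level set. *)
Lemma ge0_integral_density (f : T -> \bar R) :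
  measurable_fun [set: T] f -> (forall x, 0 <= f x)%E ->
  (\int[nu]_x f x = \int[mu]_x (f x * (g x)%:E))%E.
Proof.
move=> mf f0; pose f_ := nnsfun_approx measurableT mf.
have f_cvg x : EFin \o f_^~ x @ \oo --> f x by exact: cvg_nnsfun_approx.
have mfg n : measurable_fun [set: T] (fun x => ((f_ n x)%:E * (g x)%:E)%E).
  by apply: emeasurable_funM; apply/measurable_EFinP.
transitivity (limn (fun n => (\int[nu]_x (f_ n x)%:E)%E)).
  rewrite -monotone_convergence//.
  - by apply: eq_integral => y _; apply/esym/cvg_lim => //; exact: f_cvg.
  - by move=> n; exact/measurable_EFinP/measurable_funP.
  - by move=> n y _; rewrite lee_fin.
  - by move=> y _ m n mn; rewrite lee_fin; exact/lefP/nd_nnsfun_approx.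
transitivity (limn (fun n => (\int[mu]_x ((f_ n x)%:E * (g x)%:E))%E)); last first.
  rewrite -monotone_convergence//.
  - apply: eq_integral => y _; apply/cvg_lim => //.
    by apply: cvgeZr => //; exact: f_cvg.
  - by move=> n y _; rewrite mule_ge0// lee_fin.
  - move=> y _ m n mn; rewrite lee_wpmul2r ?lee_fin//.
    exact/lefP/nd_nnsfun_approx.
congr (limn _); apply/funext => n.
transitivity (\sum_(k \in range (f_ n)) k%:E * nu (f_ n @^-1` [set k]))%E.
  by rewrite integralT_nnsfun sintegralE.
transitivity (\sum_(k \in range (f_ n))
    \int[mu]_x ((k * \1_(f_ n @^-1` [set k]) x)%:E * (g x)%:E))%E; last first.
  rewrite -ge0_integral_fsum//.
  - apply: eq_integral => x _; rewrite [in RHS](fimfunE (f_ n)) -fsumEFin//.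
    rewrite ge0_mule_fsuml// => k; exact: nnfun_muleindic_ge0.
  - move=> k; apply: emeasurable_funM; apply/measurable_EFinP => //.
    exact: measurable_funM.
  - move=> k x _; apply: mule_ge0; last by rewrite lee_fin.
    exact: nnfun_muleindic_ge0.
apply: eq_fsbigr => k _.
(* A negative [k] has an empty level set; pulling [k] out of the integral below needs [k >= 0]. *)
have [k0|k0] := ltP k 0.
  rewrite preimage_nnfun0// measure0 mule0 integral0_eq// => x _.
  by rewrite indic0 mulr0 mul0e.
rewrite nuE//; under [RHS]eq_integral => x _ do rewrite EFinM -muleA muleC.
rewrite [RHS](_ : _ = \int[mu]_x (k%:E * (g x * \1_(f_ n @^-1` [set k]) x)%:E))%E;
  last by apply: eq_integral => x _; rewrite -!EFinM; congr (_%:E); ring.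
rewrite ge0_integralZl//.
- congr (_ * _)%E; rewrite integral_mkcond; apply: eq_integral => x _.
  by rewrite patchE indicE; case: ifPn; rewrite ?mulr1 ?mulr0.
- by apply/measurable_EFinP; apply: measurable_funM.
- by move=> x _; rewrite lee_fin mulr_ge0.
Qed.

End density.

Section normal_shift.
Context {R : realType}.
Local Notation mu := (@lebesgue_measure R).

Lemma ge0_integral_normal_prob (m s : R) (f : measurableTypeR R -> \bar R) :
  measurable_fun [set: measurableTypeR R] f -> (forall x, 0 <= f x)%E ->
  (\int[normal_prob m s]_x f x = \int[mu]_x (f x * (normal_pdf m s x)%:E))%E.
Proof.
move=> mf f0; apply: ge0_integral_density => //.
- exact: measurable_normal_pdf.
- exact: normal_pdf_ge0.
Qed.

(** The translated measure agrees with Lebesgue measure on half-open intervals, which determine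
    it. *)
Lemma lebesgue_measureD (a : R) (A : set R) : measurable A ->
  pushforward mu ((fun x => a + x) : R -> measurableTypeR R) A = mu A.
Proof.
move=> mA; apply/esym/lebesgue_measure_unique => //=.
  exact: (@measurable_funD _ _ R setT (cst a) id).
move=> mD _ [[b c]] _ <-.
rewrite /pushforward (_ : _ @^-1` _ = `](b - a), (c - a)]%classic).
  rewrite !lebesgue_measure_itv/= !lte_fin ltrD2r; case: ifP => // _.
  by rewrite -!EFinD; congr EFin; ring.
by apply/seteqP; split => x /=; rewrite !in_itv/= => /andP[h1 h2]; apply/andP; split; lra.
Qed.

Lemma ge0_integral_lebesgueD (a : R) (f : R -> \bar R) :
  measurable_fun [set: R] f -> (forall x, 0 <= f x)%E ->
  (\int[mu]_x f (a + x)%R = \int[mu]_x f x)%E.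
Proof.
move=> mf f0; transitivity
    (\int[pushforward mu ((fun x => a + x)%R : R -> measurableTypeR R)]_x f x)%E.
  rewrite ge0_integral_pushforward//.
  exact: measurable_funD.
apply: eq_measure_integral => //=.
  exact: (@measurable_funD _ _ R setT (cst a) id).
by move=> _ A mA _; exact: lebesgue_measureD.
Qed.

Lemma measurable_gauss_lr (a : R) :
  measurable_fun [set: R] (fun x => expR (a * x - a ^+ 2 / 2)).
Proof.
apply: measurableT_comp => //; exact: measurable_funB.
Qed.

(** One-dimensional Cameron-Martin formula. After translating the right-hand Lebesgue integral by
    [a], the factor exp(a (a + x) - a^2 / 2) turns the density at [a + x] into the density at
    [x]. *)
Lemma ge0_integral_normal_prob_shift (a : R) (f : measurableTypeR R -> \bar R) :
  measurable_fun [set: measurableTypeR R] f -> (forall x, 0 <= f x)%E ->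
  (\int[normal_prob 0 1]_x f (a + x)%R =
   \int[normal_prob 0 1]_x (f x * (expR (a * x - a ^+ 2 / 2))%:E))%E.
Proof.
move=> mf f0; rewrite !ge0_integral_normal_prob//; last 3 first.
- apply: emeasurable_funM => //; apply/measurable_EFinP.
  exact: measurable_gauss_lr.
- by move=> x; rewrite mule_ge0// lee_fin expR_ge0.
- by apply: measurableT_comp => //; exact: measurable_funD.
rewrite -[RHS](ge0_integral_lebesgueD a); last 2 first.
- apply: emeasurable_funM; last first.
    by apply/measurable_EFinP; exact: measurable_normal_pdf.
  apply: emeasurable_funM => //; apply/measurable_EFinP.
  exact: measurable_gauss_lr.
- move=> x; apply: mule_ge0; last by rewrite lee_fin normal_pdf_ge0.
  by apply: mule_ge0 => //; rewrite lee_fin expR_ge0.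
apply: eq_integral => x _; rewrite -muleA -EFinM; congr (_ * _%:E)%E.
rewrite normal_pdfE ?oner_neq0// /normal_fun mulrCA -expRD.
by congr (_ * expR _); rewrite expr1n; field.
Qed.

End normal_shift.

(** * Gaussian vectors *)

Section gaussian_vectors.
Context {R : realType}.

Definition dotV (n : nat) (a y : n.-tuple R) : R :=
  \sum_(i < n) tnth a i * tnth y i.

Lemma measurable_dotV (n : nat) (a : n.-tuple R) :
  measurable_fun [set: n.-tuple R] (dotV a).
Proof.
apply: measurable_sum => i.
by apply: measurable_funM => //; exact: measurable_tnth.
Qed.

Lemma dotV_cons (n : nat) (a x : R) (b y : n.-tuple R) :
  dotV [tuple of a :: b] (consV (x, y)) = a * x + dotV b y.
Proof.
rewrite /dotV big_ord_recl /consV/= !tnth0; congr +%R.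
by apply: eq_bigr => i _; rewrite !tnthS.
Qed.

Lemma dotVC (n : nat) (a b : n.-tuple R) : dotV a b = dotV b a.
Proof. by apply: eq_bigr => i _; rewrite mulrC. Qed.

Lemma dotV_ge0 (n : nat) (a b : n.-tuple R) :
  (forall i, 0 <= tnth a i) -> (forall i, 0 <= tnth b i) -> 0 <= dotV a b.
Proof. by move=> a0 b0; apply: sumr_ge0 => i _; exact: mulr_ge0. Qed.

Lemma dotV_add (n : nat) (a b y : n.-tuple R) :
  dotV a (addV b y) = dotV a b + dotV a y.
Proof.
by rewrite /dotV -big_split; apply: eq_bigr => i _; rewrite tnth_mktuple mulrDr.
Qed.

Definition scaleV (n : nat) (c : R) (a : n.-tuple R) : n.-tuple R :=
  [tuple c * tnth a i | i < n].

Lemma dotV_scale (n : nat) (c : R) (a y : n.-tuple R) :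
  dotV (scaleV c a) y = c * dotV a y.
Proof.
by rewrite /dotV mulr_sumr; apply: eq_bigr => i _; rewrite tnth_mktuple mulrA.
Qed.

(* The likelihood ratio of [law a] with respect to [std_normal n]. *)
Definition lr (n : nat) (a y : n.-tuple R) : R :=
  expR (dotV a y - dotV a a / 2).

Lemma lr_ge0 (n : nat) (a y : n.-tuple R) : 0 <= lr a y.
Proof. exact: expR_ge0. Qed.

Lemma measurable_lr (n : nat) (a : n.-tuple R) :
  measurable_fun [set: n.-tuple R] (lr a).
Proof.
apply: measurableT_comp => //; apply: measurable_funB => //.
exact: measurable_dotV.
Qed.

Lemma ge0_integral_std_normalS (n : nat) (f : n.+1.-tuple R -> \bar R) :
  measurable_fun [set: n.+1.-tuple R] f -> (forall y, 0 <= f y)%E ->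
  (\int[std_normal n.+1]_y f y =
   \int[normal_prob 0 1]_x \int[std_normal n]_y f (consV (x, y)))%E.
Proof.
move=> mf f0; rewrite ge0_integral_distribution// fubini_tonelli1//; last by move=> z /=.
by apply: measurableT_comp => //; exact: measurable_consV.
Qed.

(** Cameron-Martin formula in dimension [n], by induction: Tonelli isolates the first coordinate,
    where the scalar formula applies, and [lr] is multiplicative over coordinates. *)
Lemma ge0_integral_std_normal_shift (n : nat) (a : n.-tuple R)
    (f : n.-tuple R -> \bar R) :
  measurable_fun [set: n.-tuple R] f -> (forall y, 0 <= f y)%E ->
  (\int[std_normal n]_y f (addV a y) =
   \int[std_normal n]_y (f y * (lr a y)%:E))%E.
Proof.
elim: n a f => [|n IH] a f mf f0.
  rewrite !integral_dirac//=.
  - by rewrite [addV _ _]tuple0 /lr /dotV !big_ord0 mul0r subr0 expR0 mule1.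
  - by apply: emeasurable_funM => //; apply/measurable_EFinP; exact: measurable_lr.
  - by apply: measurableT_comp => //; exact: measurable_addV.
have mfc := measurableT_comp mf (@measurable_consV R n).
case/tupleP: a => a a'.
have mflr : measurable_fun [set: measurableTypeR R * n.-tuple R]
    (fun z => (f (consV z) * (lr a' z.2)%:E)%E).
  apply: (@emeasurable_funM _ (measurableTypeR R * n.-tuple R)%type R setT
    (f \o @consV R n) (fun z => (lr a' z.2)%:E) mfc).
  apply/measurable_EFinP; apply: measurableT_comp => //; exact: measurable_lr.
have flr0 z : (0 <= f (consV z) * (lr a' z.2)%:E)%E.
  by rewrite mule_ge0// lee_fin lr_ge0.
have addE x y : addV [tuple of a :: a'] (consV (x, y)) = consV (a + x, addV a' y).
  apply: eq_from_tnth => i; rewrite tnth_mktuple /consV /=.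
  by case: (unliftP ord0 i) => [j|] ->; rewrite ?tnth0 ?tnthS ?tnth_mktuple.
have lrE x y : lr [tuple of a :: a'] (consV (x, y)) =
    expR (a * x - a ^+ 2 / 2) * lr a' y.
  by rewrite /lr !dotV_cons -expRD; congr expR; field.
pose F x := (\int[std_normal n]_y (f (consV (x, y)) * (lr a' y)%:E))%E.
have mF : measurable_fun [set: measurableTypeR R] F.
  exact: (measurable_fun_fubini_tonelli_F (m2 := std_normal n) _ mflr flr0).
have F0 x : (0 <= F x)%E by apply: integral_ge0 => y _; exact: (flr0 (x, y)).
transitivity (\int[normal_prob 0 1]_x F (a + x)%R)%E.
  have mfa : measurable_fun [set: n.+1.-tuple R] (f \o addV [tuple of a :: a']).
    by apply: measurableT_comp => //; exact: measurable_addV.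
  rewrite (ge0_integral_std_normalS mfa (fun y => f0 (addV _ y)))/=.
  apply: eq_integral => x _.
  under eq_integral => y _ do rewrite addE.
  rewrite (IH a' (fun y => f (consV (a + x, y))))//.
  exact: (measurableT_comp mfc (pair1_measurable (a + x : measurableTypeR R))).
rewrite (ge0_integral_normal_prob_shift a mF F0).
have mflrS : measurable_fun [set: n.+1.-tuple R]
    (fun y => f y * (lr [tuple of a :: a'] y)%:E)%E.
  by apply: emeasurable_funM => //; apply/measurable_EFinP; exact: measurable_lr.
have flrS0 y : (0 <= f y * (lr [tuple of a :: a'] y)%:E)%E.
  by rewrite mule_ge0// lee_fin lr_ge0.
rewrite (ge0_integral_std_normalS mflrS flrS0).
apply: eq_integral => x _.
have mFx : measurable_fun [set: n.-tuple R]
    (fun y => f (consV (x, y)) * (lr a' y)%:E)%E.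
  exact: (measurableT_comp mflr (pair1_measurable (x : measurableTypeR R))).
transitivity (\int[std_normal n]_y (f (consV (x, y)) * (lr a' y)%:E *
    (expR (a * x - a ^+ 2 / 2))%:E))%E; last first.
  by apply: eq_integral => y _; rewrite lrE EFinM -muleA; congr (_ * _)%E; rewrite muleC.
by apply/esym; apply: ge0_integralZr.
Qed.

End gaussian_vectors.

(** * Likelihood ratios, Chernoff bound and independence of projections *)

Section gaussian_inequalities.
Context {R : realType}.

Lemma lawE (n : nat) (a : n.-tuple R) (A : set (n.-tuple R)) : measurable A ->
  law a A = (\int[std_normal n]_(y in A) (lr a y)%:E)%E.
Proof.
move=> mA.
have mf : measurable_fun [set: n.-tuple R] (fun y => (\1_A y)%:E : \bar R).
  by apply/measurable_EFinP; exact: measurable_indic.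
have mpA : measurable (addV a @^-1` A).
  by rewrite -[X in measurable X]setTI; exact: measurable_addV.
transitivity (\int[std_normal n]_y (\1_A (addV a y))%:E)%E.
  rewrite -[LHS]/(std_normal n (addV a @^-1` A)) -[X in std_normal _ X]setIT.
  by rewrite -integral_indic.
rewrite (ge0_integral_std_normal_shift a mf); last by move=> y; rewrite lee_fin.
rewrite [RHS]integral_mkcond; apply: eq_integral => y _.
by rewrite patchE indicE; case: ifPn; rewrite ?mul1e ?mul0e.
Qed.

Lemma integral_lr (n : nat) (a : n.-tuple R) :
  (\int[std_normal n]_y (lr a y)%:E = 1)%E.
Proof. by rewrite -lawE// probability_setT. Qed.

Lemma measurable_dotV_le (n : nat) (b : n.-tuple R) (u : R) :
  measurable [set y | dotV b y <= u].
Proof.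
rewrite (_ : [set _ | _] = [set: n.-tuple R] `&` dotV b @^-1` `]-oo, u]%classic).
  exact: measurable_dotV.
by rewrite setTI; apply/seteqP; split => y /=; rewrite in_itv.
Qed.

Lemma measurable_dotV_ge (n : nat) (b : n.-tuple R) (u : R) :
  measurable [set y | u <= dotV b y].
Proof.
rewrite (_ : [set _ | _] = [set: n.-tuple R] `&` dotV b @^-1` `[u, +oo[%classic).
  exact: measurable_dotV.
by rewrite setTI; apply/seteqP; split => y /=; rewrite in_itv/= andbT.
Qed.

(** Exponential Markov inequality: with [C] the announced bound, [C * lr (scaleV t b) y] equals
    exp(t (b.y - u)), which is at least 1 on the event and integrates to [C]. *)
Lemma std_normal_chernoff (n : nat) (b : n.-tuple R) (u t : R) : 0 <= t ->
  (std_normal n [set y | (u <= dotV b y)%R] <=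
   (expR (- (t * u) + t ^+ 2 * dotV b b / 2))%:E)%E.
Proof.
move=> t0; set A := [set y | _]; set C := expR _.
have mA : measurable A by exact: measurable_dotV_ge.
have mlr := measurable_lr (scaleV t b).
apply: (@le_trans _ _ (\int[std_normal n]_(y in A) (C * lr (scaleV t b) y)%:E)%E).
  rewrite -[leLHS]mul1e -integral_cst//; apply: ge0_le_integral => //.
  - by apply/measurable_EFinP; apply: measurable_funM => //; exact: measurable_funTS.
  move=> y; rewrite /A/= lee_fin => uy; rewrite /C /lr -expRD -expR0 ler_expR.
  rewrite !dotV_scale (dotVC b (scaleV t b)) dotV_scale.
  have : t * u <= t * dotV b y by rewrite ler_wpM2l.
  lra.
apply: (@le_trans _ _ (\int[std_normal n]_y (C * lr (scaleV t b) y)%:E)%E).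
  apply: ge0_subset_integral => //.
  - by apply/measurable_EFinP; apply: measurable_funM.
  - by move=> y _; rewrite lee_fin mulr_ge0 ?expR_ge0 ?lr_ge0.
under eq_integral do rewrite EFinM.
rewrite ge0_integralZl ?lee_fin ?expR_ge0 ?integral_lr ?mule1//.
- exact/measurable_EFinP.
- by move=> y _; rewrite lee_fin lr_ge0.
Qed.

Lemma measurable_consV_section (n : nat) (A : set (n.+1.-tuple R)) : measurable A ->
  measurable_fun [set: measurableTypeR R]
    (fun x => std_normal n [set y | A (consV (x, y))]).
Proof.
move=> mA; have mA' : measurable (@consV R n @^-1` A).
  by rewrite -[X in measurable X]setTI; exact: measurable_consV.
rewrite (_ : (fun _ => _) = std_normal n \o xsection (@consV R n @^-1` A)).
  exact: (measurable_fun_xsection (std_normal n) mA').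
apply/funext => x /=; congr (std_normal n _).
by apply/seteqP; split => y; rewrite /xsection/= inE.
Qed.

Lemma std_normalS (n : nat) (A : set (n.+1.-tuple R)) : measurable A ->
  (std_normal n.+1 A =
   \int[normal_prob 0 1]_x std_normal n [set y | A (consV (x, y))])%E.
Proof.
move=> mA; apply: eq_integral => x _ /=; congr (std_normal n _).
by apply/seteqP; split => y; rewrite /xsection/= inE.
Qed.

(** Induction on the dimension. One of the two leading coefficients vanishes, by symmetry that of
    [b]; the second event then ignores the first coordinate, and its probability leaves the integral
    over that coordinate. *)
Lemma std_normal_indep (n : nat) (a b : n.-tuple R) (s t : R) :
  (forall i, tnth a i * tnth b i = 0) ->
  (std_normal n [set y | (dotV a y <= s /\ dotV b y <= t)%R] =
   std_normal n [set y | (dotV a y <= s)%R] *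
   std_normal n [set y | (dotV b y <= t)%R])%E.
Proof.
elim: n a b s t => [|n IH] a b s t.
  move=> _; rewrite /= !diracE.
  rewrite -[[set y | _ /\ _]]/([set y | dotV a y <= s] `&` [set y | dotV b y <= t]).
  by rewrite in_setI -EFinM -natrM mulnb.
have mAB a1 b1 : measurable [set y : n.+1.-tuple R | dotV a1 y <= s /\ dotV b1 y <= t].
  by apply: measurableI; exact: measurable_dotV_le.
case/tupleP: a => a a'; case/tupleP: b => b b' ab.
have ab' i : tnth a' i * tnth b' i = 0.
  by have := ab (lift ord0 i); rewrite !tnthS.
have {ab} : a * b = 0 by have := ab ord0; rewrite !tnth0.
wlog b0 : a b a' b' s t mAB ab' / b = 0 => [W|_].
  move=> ab0; have := ab0 => /eqP; rewrite mulf_eq0 => /orP[|] /eqP h; last exact: W.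
  rewrite muleC -W//; last 3 first.
  - by move=> a1 b1; apply: measurableI; exact: measurable_dotV_le.
  - by move=> i; rewrite mulrC.
  - by rewrite h mulr0.
  by congr (std_normal _ _); apply/seteqP; split => y /= [].
subst b.
have mA := measurable_dotV_le [tuple of a :: a'] s.
rewrite !std_normalS//; last exact: measurable_dotV_le.
have -> : (\int[normal_prob 0 1]_x
    std_normal n [set y | (dotV [tuple of 0 :: b'] (consV (x, y)) <= t)%R] =
    std_normal n [set y | (dotV b' y <= t)%R])%E.
  under eq_integral => x _.
    rewrite (_ : [set y | _] = [set y | (dotV b' y <= t)%R]); last first.
      by apply/seteqP; split => y /=; rewrite dotV_cons mul0r add0r.
    over.
  rewrite integral_cst// -[RHS]mule1; congr (_ * _)%E.
  exact: (@probability_setT _ _ R (normal_prob 0 1)).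
rewrite -ge0_integralZr//; last exact: measurable_consV_section.
apply: eq_integral => x _ /=.
rewrite (_ : [set y | _] = [set y | (dotV a' y <= s - a * x /\ dotV b' y <= t)%R]).
  rewrite IH//; congr (_ * _)%E; congr (std_normal _ _).
  by apply/seteqP; split => y /=; rewrite dotV_cons lerBrDl.
by apply/seteqP; split => y /=; rewrite !dotV_cons lerBrDl mul0r add0r.
Qed.

End gaussian_inequalities.

(** * Testing against a truncated mixture *)

Section second_moment.
Context d (T : measurableType d) (R : realType) (P : probability T R).

(** Here [X] is a truncated likelihood ratio of mean [nu] and variance at most [sigma ^+ 2]. A
    pointwise quadratic inequality is integrated in place of Cauchy-Schwarz; it is arranged so that
    both sides are nonnegative. *)
Lemma second_moment_testing (X : T -> R) (A : set T) (nu sigma : R) :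
  measurable_fun [set: T] X -> (forall x, 0 <= X x) -> measurable A ->
  0 < sigma -> nu <= 1 ->
  (\int[P]_x (X x)%:E = nu%:E)%E ->
  (\int[P]_x (X x ^+ 2)%:E <= (nu ^+ 2 + sigma ^+ 2)%:E)%E ->
  ((nu - sigma)%:E <= P A + \int[P]_(x in ~` A) (X x)%:E)%E.
Proof.
move=> mX X0 mA s0 nu1 EX EX2.
have nu0 : 0 <= nu.
  by rewrite -lee_fin -EX; apply: integral_ge0 => x _; rewrite lee_fin.
have mXC : measurable_fun [set: T] (fun x => X x * \1_(~` A) x).
  by apply: measurable_funM => //; apply: measurable_indic; exact: measurableC.
have EXC : (\int[P]_(x in ~` A) (X x)%:E = \int[P]_x (X x * \1_(~` A) x)%:E)%E.
  rewrite integral_mkcond; apply: eq_integral => x _.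
  by rewrite patchE indicE; case: ifPn; rewrite ?mulr1 ?mulr0.
have [b bE] : exists b, (\int[P]_(x in ~` A) (X x)%:E = b%:E)%E.
  exists (fine (\int[P]_(x in ~` A) (X x)%:E)%E).
  rewrite fineK// ge0_fin_numE; last first.
    by apply: integral_ge0 => x _; rewrite lee_fin.
  rewrite (@le_lt_trans _ _ nu%:E) ?ltry// -EX ge0_subset_integral//.
  - exact: measurableC.
  - exact/measurable_EFinP.
  - by move=> x _; rewrite lee_fin.
have [m mE] : exists m, (\int[P]_x (X x ^+ 2)%:E = m%:E)%E.
  exists (fine (\int[P]_x (X x ^+ 2)%:E)%E); rewrite fineK// ge0_fin_numE; last first.
    by apply: integral_ge0 => x _; rewrite lee_fin sqr_ge0.
  exact: (le_lt_trans EX2 (ltry _)).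
have [a aE] : exists a, P A = a%:E.
  by exists (fine (P A)); rewrite fineK// fin_num_measure.
have mX2 : measurable_fun [set: T] (fun x => X x ^+ 2) by exact: measurable_funX.
have Ecst c : (\int[P]_x c%:E = c%:E)%E.
  by rewrite integral_cst// -[RHS]mule1; congr (_ * _)%E; exact: probability_setT.
have m1A : measurable_fun [set: T] (\1_A : T -> R) by exact: measurable_indic.
have E1A : (\int[P]_x (\1_A x)%:E = a%:E)%E.
  by rewrite integral_indic// setIT; exact: aE.
have g1 : (\int[P]_x (2 * sigma * (\1_A x + X x * \1_(~` A) x) +
    (X x ^+ 2 + (nu ^+ 2 + sigma ^+ 2)))%:E =
    (2 * sigma * (a + b) + (m + (nu ^+ 2 + sigma ^+ 2)))%:E)%E.
  under eq_integral do rewrite EFinD EFinM.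
  have p1 x : 0 <= \1_A x + X x * \1_(~` A) x by rewrite addr_ge0// mulr_ge0.
  rewrite ge0_integralD//; last 4 first.
  - by move=> x _; rewrite -EFinM lee_fin mulr_ge0// mulr_ge0// ltW.
  - by apply/measurable_EFinP; apply: measurable_funM => //; exact: measurable_funD.
  - by move=> x _; rewrite lee_fin !addr_ge0// sqr_ge0.
  - by apply/measurable_EFinP; exact: measurable_funD.
  rewrite ge0_integralZl//; last 3 first.
  - by apply/measurable_EFinP; exact: measurable_funD.
  - by move=> x _; rewrite lee_fin.
  - by rewrite lee_fin mulr_ge0// ltW.
  under eq_integral do rewrite EFinD.
  rewrite ge0_integralD//; last 3 first.
  - exact/measurable_EFinP.
  - by move=> x _; rewrite lee_fin mulr_ge0.
  - exact/measurable_EFinP.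
  rewrite -EXC bE E1A.
  under [X in (_ + X)%E]eq_integral do rewrite EFinD.
  rewrite ge0_integralD//; last 3 first.
  - by move=> x _; rewrite lee_fin sqr_ge0.
  - exact/measurable_EFinP.
  - by move=> x _; rewrite lee_fin addr_ge0// sqr_ge0.
  by rewrite mE Ecst.
have g2 : (\int[P]_x (2 * sigma * nu + 2 * nu * X x)%:E =
    (2 * sigma * nu + 2 * nu * nu)%:E)%E.
  under eq_integral do rewrite EFinD (EFinM (2 * nu)).
  rewrite ge0_integralD//; last 3 first.
  - by move=> x _; rewrite lee_fin !mulr_ge0// ltW.
  - by move=> x _; rewrite -EFinM lee_fin !mulr_ge0.
  - by apply/measurable_EFinP; exact: measurable_funM.
  rewrite ge0_integralZl//; last 3 first.
  - exact/measurable_EFinP.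
  - by move=> x _; rewrite lee_fin.
  - by rewrite lee_fin mulr_ge0.
  by rewrite EX Ecst.
have : (\int[P]_x (2 * sigma * nu + 2 * nu * X x)%:E <=
   \int[P]_x (2 * sigma * (\1_A x + X x * \1_(~` A) x) +
    (X x ^+ 2 + (nu ^+ 2 + sigma ^+ 2)))%:E)%E.
  apply: ge0_le_integral => //.
  - by move=> x _; rewrite lee_fin addr_ge0// !mulr_ge0// ltW.
  - apply/measurable_EFinP; apply: measurable_funD => //; exact: measurable_funM.
  - apply/measurable_EFinP; apply: measurable_funD; last exact: measurable_funD.
    by apply: measurable_funM => //; exact: measurable_funD.
  (* On A this is [(X - nu)^2 + sigma^2 + 2 sigma (1 - nu) >= 0], off A it is
     [(X - nu + sigma)^2 >= 0]. *)
  move=> x _; rewrite lee_fin !indicE in_setC; case: (x \in A) => /=.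
    rewrite mulr0 addr0.
    have : 0 <= sigma * (1 - nu) by rewrite mulr_ge0 ?subr_ge0// ltW.
    have := sqr_ge0 (X x - nu); have := sqr_ge0 sigma; nra.
  have := sqr_ge0 (X x - nu + sigma); nra.
rewrite g1 g2 bE aE -EFinD !lee_fin => h.
move: EX2; rewrite mE lee_fin => h2.
have : 0 <= (2 * sigma) * ((a + b) - (nu - sigma)) by nra.
by rewrite pmulr_rge0 ?mulr_gt0// subr_ge0.
Qed.

End second_moment.

(** * Second moment of the truncated mixture likelihood ratio *)

Section gaussian_mixture.
Context {R : realType}.

Lemma law_dotV_le (n : nat) (a b : n.-tuple R) (u : R) :
  law a [set y | dotV b y <= u] = std_normal n [set y | dotV b y <= u - dotV b a].
Proof.
rewrite /law/= /distribution/pushforward/=; congr (std_normal n _).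
by apply/seteqP; split => y /=; rewrite dotV_add lerBrDl.
Qed.

(** This turns each cross term of the second moment into exp(a.b) times a probability under the law
    centred at [addV a b]. *)
Lemma lrM (n : nat) (a b y : n.-tuple R) :
  lr a y * lr b y = expR (dotV a b) * lr (addV a b) y.
Proof.
rewrite /lr -!expRD; congr expR.
have addl z : dotV (addV a b) z = dotV a z + dotV b z.
  by rewrite dotVC dotV_add !(dotVC z).
by rewrite !addl !dotV_add (dotVC b a); field.
Qed.

Lemma integral_lr_indic (n : nat) (a : n.-tuple R) (B : set (n.-tuple R)) (c : R) :
  measurable B -> 0 <= c ->
  (\int[std_normal n]_y (c * (lr a y * \1_B y))%:E = c%:E * law a B)%E.
Proof.
move=> mB c0; rewrite lawE// [in RHS]integral_mkcond.
under [LHS]eq_integral do rewrite EFinM.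
rewrite ge0_integralZl ?lee_fin//; last 2 first.
- apply/measurable_EFinP; apply: measurable_funM; first exact: measurable_lr.
  exact: measurable_indic.
- by move=> y _; rewrite lee_fin mulr_ge0// lr_ge0.
congr (_ * _)%E; apply: eq_integral => y _.
by rewrite patchE indicE; case: ifPn; rewrite ?mulr1 ?mulr0.
Qed.

Lemma law_fin (n : nat) (a : n.-tuple R) (B : set (n.-tuple R)) : measurable B ->
  law a B = (fine (law a B))%:E.
Proof. by move=> mB; rewrite fineK// fin_num_measure. Qed.

(** Abstract form of the family of alternatives: [eps] bounds the squared norm lost in passing from
    [theta k] to [beta k], and [delta] bounds the correlations. *)
Variables (n K : nat) (theta beta : 'I_K -> n.-tuple R) (r s delta eps : R).
Hypotheses (K0 : (0 < K)%N) (s0 : 0 <= s) (sr : s <= r) (r0 : 0 < r)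
  (eps0 : 0 <= eps) (delta0 : 0 <= delta).
Hypothesis theta0 : forall k i, 0 <= tnth (theta k) i.
Hypothesis beta0 : forall k i, 0 <= tnth (beta k) i.
Hypothesis beta_disj : forall j k i, j != k -> tnth (beta j) i * tnth (beta k) i = 0.
Hypothesis beta_theta : forall k, dotV (beta k) (theta k) = dotV (beta k) (beta k).
Hypothesis beta_lb : forall k, r ^+ 2 - eps <= dotV (beta k) (beta k).
Hypothesis beta_ub : forall k, dotV (beta k) (beta k) <= r ^+ 2.
Hypothesis theta_norm : forall k, dotV (theta k) (theta k) = r ^+ 2.
Hypothesis theta_corr : forall j k, j != k -> dotV (theta j) (theta k) <= delta.

Let v k := dotV (beta k) (beta k).
Let B k := [set y | dotV (beta k) y <= v k + s * r].
Let mB k : measurable (B k).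
Proof. exact: measurable_dotV_le. Qed.
Let p k := fine (law (theta k) (B k)).

Let pE k : law (theta k) (B k) = (p k)%:E. Proof. exact: law_fin. Qed.
Let p0 k : 0 <= p k. Proof. exact: fine_ge0. Qed.
Let p1 k : p k <= 1. Proof. by rewrite -lee_fin -pE probability_le1. Qed.

Let pE' k : std_normal n [set y | dotV (beta k) y <= s * r] = (p k)%:E.
Proof. by rewrite -pE law_dotV_le beta_theta addrAC subrr add0r. Qed.

Let p_lb k : 1 - expR (- s ^+ 2 / 2) <= p k.
Proof.
have mA := measurable_dotV_le (beta k) (s * r).
have : (1 - (p k)%:E <= (expR (- s ^+ 2 / 2))%:E)%E.
  rewrite -pE' -probability_setC//.
  apply: (@le_trans _ _ (std_normal n [set y | (s * r <= dotV (beta k) y)%R])).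
    apply: le_measure; rewrite ?inE; [exact: measurableC|exact: measurable_dotV_ge|].
    by move=> y /= /negP; rewrite -ltNge => /ltW.
  (* The choice [t = s / r] is optimal when [beta k] has norm [r]; a smaller norm only improves the
     bound. *)
  apply: le_trans (std_normal_chernoff (beta k) (s * r) (t := s / r) _) _.
    by rewrite divr_ge0// ltW.
  rewrite lee_fin ler_expR.
  have -> : s / r * (s * r) = s ^+ 2 by field; rewrite gt_eqF.
  have : (s / r) ^+ 2 * dotV (beta k) (beta k) <= s ^+ 2.
    rewrite exprMn exprVn -mulrA ler_piMr ?sqr_ge0// mulrC ler_pdivrMr ?mul1r//.
    exact: exprn_gt0.
  lra.
by rewrite -EFinB lee_fin; lra.
Qed.

(* The entries being nonnegative, the mean of the projection on beta_j is at
   least as large under theta_j + theta_k as under theta_j. *)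
Let offdiag j k : j != k ->
  (law (addV (theta j) (theta k)) (B j `&` B k) <= (p j * p k)%:E)%E.
Proof.
move=> jk; rewrite EFinM -!pE' -std_normal_indep; last by move=> i; exact: beta_disj.
rewrite /law/= /distribution/pushforward/=; apply: le_measure; rewrite ?inE.
- rewrite -[X in measurable X]setTI; apply: measurable_addV => //.
  exact: measurableI.
- by apply: measurableI; exact: measurable_dotV_le.
move=> y []; rewrite /B /= !dotV_add beta_theta -/(v j) -/(v k).
have := beta_theta k; rewrite -/(v k) => ->.
have := dotV_ge0 (beta0 j) (theta0 k); have := dotV_ge0 (beta0 k) (theta0 j).
by split; lra.
Qed.

(** Under twice [theta k] the projection has mean [2 * v k], so [B k] is a downward deviation by
    [v k - s * r], estimated by Chernoff's bound for the opposite vector. *)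
Let diag k : (law (addV (theta k) (theta k)) (B k) <=
  (expR (- (r - s) ^+ 2 / 2 + eps))%:E)%E.
Proof.
rewrite law_dotV_le dotV_add beta_theta -/(v k).
set b := scaleV (-1) (beta k).
have bb : dotV b b = v k.
  by rewrite /b dotV_scale (dotVC (beta k)) dotV_scale /v; ring.
rewrite (_ : [set y | _] = [set y | v k - s * r <= dotV b y]); last first.
  by apply/seteqP; split => y /=; rewrite dotV_scale; lra.
have t0 : 0 <= 1 - s / r by rewrite subr_ge0 ler_pdivrMr ?mul1r.
apply: le_trans (std_normal_chernoff b _ t0) _.
rewrite lee_fin ler_expR bb.
have h1 : r ^+ 2 - eps <= v k := beta_lb k.
have h2 : v k <= r ^+ 2 := beta_ub k.
set t := 1 - s / r in t0 *.
have tr : t * r = r - s by rewrite /t; field; rewrite gt_eqF.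
have t1 : t <= 1 by rewrite /t lerBlDr lerDl divr_ge0// ltW.
(* The exponent is affine in [v k] with slope [-(t - t ^+ 2 / 2)], which lies in [-1, 0]; replacing
   [v k] by [r ^+ 2] therefore costs at most [eps]. *)
have c0 : 0 <= t - t ^+ 2 / 2 by nra.
have c1 : t - t ^+ 2 / 2 <= 1 by nra.
have : 0 <= (t - t ^+ 2 / 2) * (v k - (r ^+ 2 - eps)) by rewrite mulr_ge0// subr_ge0.
have : 0 <= (1 - (t - t ^+ 2 / 2)) * eps by rewrite mulr_ge0// subr_ge0.
have -> : s = r - t * r by rewrite tr; ring.
nra.
Qed.

(** The second-moment bound applied to the truncated mixture: its mean is at least 1 - exp(- s^2 /
    2), and [sigma ^+ 2] dominates its variance, a diagonal term plus a correlation term. *)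
Lemma gaussian_mixture_testing (A : set (n.-tuple R)) (sigma : R) :
  measurable A -> 0 < sigma ->
  expR (r ^+ 2 / 2 + r * s - s ^+ 2 / 2 + eps) / K%:R + (expR delta - 1)
    <= sigma ^+ 2 ->
  ((1 - expR (- s ^+ 2 / 2) - sigma)%:E <=
   std_normal n A + \sum_(k < K) (K%:R^-1)%:E * law (theta k) (~` A))%E.
Proof.
move=> mA sigma0 hsigma.
have K0' : 0 < K%:R :> R by rewrite ltr0n.
have Ki0 : 0 <= K%:R^-1 :> R by rewrite invr_ge0 ltW.
pose X y : R := \sum_(k < K) K%:R^-1 * (lr (theta k) y * \1_(B k) y).
pose nu : R := \sum_(k < K) K%:R^-1 * p k.
have sumK (c : R) : \sum_(k < K) K%:R^-1 * c = c.
  by rewrite sumr_const card_ord -mulrnAl -(mulr_natr K%:R^-1) mulVf ?mul1r ?gt_eqF.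
have term0 k y : 0 <= K%:R^-1 * (lr (theta k) y * \1_(B k) y).
  by rewrite !mulr_ge0// lr_ge0.
have mterm k : measurable_fun [set: n.-tuple R]
    (fun y => K%:R^-1 * (lr (theta k) y * \1_(B k) y)).
  by apply: measurable_funM => //; apply: measurable_funM;
    [exact: measurable_lr|exact: measurable_indic].
have X0 y : 0 <= X y by apply: sumr_ge0.
have mX : measurable_fun [set: n.-tuple R] X by exact: measurable_sum.
have EX : (\int[std_normal n]_y (X y)%:E = nu%:E)%E.
  under eq_integral do rewrite -sumEFin.
  rewrite ge0_integral_sum//; last 2 first.
  - by move=> k; exact/measurable_EFinP.
  - by move=> k y _; rewrite lee_fin.
  rewrite -sumEFin; apply: eq_bigr => k _.
  by rewrite integral_lr_indic// pE -EFinM.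
have nu_lb : 1 - expR (- s ^+ 2 / 2) <= nu.
  by rewrite -[leLHS]sumK; apply: ler_sum => k _; rewrite ler_wpM2l.
have nu1 : nu <= 1.
  by rewrite -[leRHS]sumK; apply: ler_sum => k _; rewrite ler_wpM2l.
have EX2 : (\int[std_normal n]_y (X y ^+ 2)%:E <= (nu ^+ 2 + sigma ^+ 2)%:E)%E.
  pose D := expR (r ^+ 2 / 2 + r * s - s ^+ 2 / 2 + eps).
  pose c j k := K%:R^-1 * K%:R^-1 * expR (dotV (theta j) (theta k)).
  pose f j k y := c j k * (lr (addV (theta j) (theta k)) y * \1_(B j `&` B k) y).
  have c0 j k : 0 <= c j k by rewrite !mulr_ge0// expR_ge0.
  have f0 j k y : 0 <= f j k y by rewrite !mulr_ge0// lr_ge0.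
  have mBB j k : measurable (B j `&` B k) by exact: measurableI.
  have mf j k : measurable_fun [set: n.-tuple R] (f j k).
    by apply: measurable_funM => //; apply: measurable_funM;
      [exact: measurable_lr|exact: measurable_indic].
  have X2E y : X y ^+ 2 = \sum_(j < K) \sum_(k < K) f j k y.
    rewrite expr2 {1}/X mulr_suml; apply: eq_bigr => j _.
    rewrite mulr_sumr; apply: eq_bigr => k _.
    rewrite /f /c -!mulrA [in RHS](mulrA (expR _)) -lrM indicI /=.
    ring.
  under eq_integral do rewrite X2E -sumEFin.
  rewrite ge0_integral_sum//; last 2 first.
  - by move=> j; apply/measurable_EFinP; exact: measurable_sum.
  - by move=> j y _; rewrite lee_fin sumr_ge0.
  (* The nonnegative term [expR delta * (p j * p k)] is kept on the diagonal too, so that the double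
     sum factors as [expR delta * nu ^+ 2 + D / K%:R]. *)
  apply: (@le_trans _ _ (\sum_(j < K) \sum_(k < K)
    (K%:R^-1 * K%:R^-1 * (expR delta * (p j * p k) + (j == k)%:R * D))%:E)%E).
    apply: lee_sum => j _; under eq_integral do rewrite -sumEFin.
    rewrite ge0_integral_sum//; last 2 first.
    - by move=> k; exact/measurable_EFinP.
    - by move=> k y _; rewrite lee_fin.
    apply: lee_sum => k _; rewrite integral_lr_indic// (law_fin _ (mBB j k)).
    rewrite -EFinM lee_fin /c -!mulrA; do 2 rewrite ler_wpM2l//.
    have [<-|jk] := eqVneq j k.
      rewrite mul1r theta_norm setIid.
      have : fine (law (addV (theta j) (theta j)) (B j)) <=
          expR (- (r - s) ^+ 2 / 2 + eps).
        by rewrite -lee_fin -law_fin.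
      move=> /(ler_wpM2l (expR_ge0 (r ^+ 2))) /le_trans; apply.
      rewrite -expRD.
      rewrite (_ : r ^+ 2 + _ = r ^+ 2 / 2 + r * s - s ^+ 2 / 2 + eps); last by field.
      by rewrite lerDr !mulr_ge0// expR_ge0.
    rewrite mul0r addr0; apply: ler_pM; rewrite ?expR_ge0 ?fine_ge0//.
      by rewrite ler_expR theta_corr.
    by rewrite -lee_fin -law_fin// offdiag.
  under eq_bigr do rewrite sumEFin.
  rewrite sumEFin lee_fin.
  have -> : \sum_(j < K) \sum_(k < K)
      K%:R^-1 * K%:R^-1 * (expR delta * (p j * p k) + (j == k)%:R * D) =
      expR delta * nu ^+ 2 + D / K%:R.
    transitivity (\sum_(j < K)
        (expR delta * (K%:R^-1 * p j * nu) + K%:R^-1 * (D / K%:R))).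
      apply: eq_bigr => j _; rewrite /nu !mulr_sumr.
      rewrite (bigD1 j)//= eqxx mul1r [in RHS](bigD1 j)//= addrAC -addrA.
      rewrite (eq_bigr (fun i => expR delta * (K%:R^-1 * p j * (K%:R^-1 * p i)))).
        ring.
      by move=> k /negbTE jk; rewrite eq_sym jk mul0r addr0; ring.
    rewrite big_split/= sumK -mulr_sumr expr2; congr (_ * _ + _).
    by rewrite /nu mulr_suml.
  have e1 : 1 <= expR delta by rewrite -expR0 ler_expR.
  have nu0 : 0 <= nu by apply: sumr_ge0 => k _; rewrite mulr_ge0.
  have : (expR delta - 1) * nu ^+ 2 <= expR delta - 1.
    by rewrite ler_piMr ?subr_ge0// expr_le1.
  move: hsigma; rewrite -/D; lra.
apply: (@le_trans _ _ (std_normal n A + \int[std_normal n]_(y in ~` A) (X y)%:E)%E).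
  apply: le_trans (second_moment_testing mX X0 mA sigma0 nu1 EX EX2).
  by rewrite lee_fin lerB.
(* Dropping the indicators of the [B k] can only increase the integral over the complement of
   [A]. *)
rewrite leeD2l//.
have mC : measurable (~` A) by exact: measurableC.
under eq_integral do rewrite -sumEFin.
rewrite ge0_integral_sum//; last 2 first.
- by move=> k; apply/measurable_EFinP; exact: measurable_funTS.
- by move=> k y _; rewrite lee_fin.
apply: lee_sum => k _; rewrite lawE//.
rewrite -ge0_integralZl//; last 2 first.
- by apply/measurable_EFinP; apply: measurable_funTS; exact: measurable_lr.
- by move=> y _; rewrite lee_fin lr_ge0.
apply: ge0_le_integral => //.
- by move=> y _; rewrite lee_fin.
- by apply/measurable_EFinP; exact: measurable_funTS.
- apply/measurable_EFinP; apply: measurable_funM => //.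
  by apply: measurable_funTS; exact: measurable_lr.
- move=> y _; rewrite lee_fin ler_wpM2l// indicE.
  by rewrite ler_piMr ?lr_ge0//; case: (_ \in _).
Qed.

End gaussian_mixture.

(** * Geometric change-points *)

Section step_vectors.
Context {R : realType}.

Definition stepV (n a b : nat) (c : R) : n.-tuple R :=
  [tuple if (a <= i < b)%N then c else 0 | i < n].

Lemma tnth_stepV (n a b : nat) (c : R) (i : 'I_n) :
  tnth (stepV n a b c) i = if (a <= i < b)%N then c else 0.
Proof. exact: tnth_mktuple. Qed.

Lemma stepV_ge0 (n a b : nat) (c : R) (i : 'I_n) : 0 <= c ->
  0 <= tnth (stepV n a b c) i.
Proof. by move=> c0; rewrite tnth_stepV; case: ifP. Qed.

Lemma dotV_stepV (n a b a' b' : nat) (c c' : R) :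
  (b <= n)%N -> (a' <= a)%N -> (b <= b')%N ->
  dotV (stepV n a b c) (stepV n a' b' c') = (b - a)%:R * (c * c').
Proof.
move=> bn aa bb; rewrite mulr_natl -sumr_const_nat (big_nat_widen _ _ _ _ _ bn)/=.
rewrite (big_nat_widenl _ _ _ _ _ (leq0n a)) big_mkord [RHS]big_mkcond /=.
apply: eq_bigr => i _; rewrite !tnth_stepV andbC.
case: ifP => [/andP[ib ai]|]; last by rewrite mul0r.
by rewrite (leq_trans aa ai) (leq_trans ib bb).
Qed.

(** Change-points are numbered from 1, so [m] leading entries give the change-point [m.+1]. *)
Lemma stepV_change_point (n m : nat) (c : R) : (0 < m)%N -> (m < n)%N -> c != 0 ->
  is_change_point (stepV n 0 m c) m.+1 c 0.
Proof.
move=> m0 mn c0; split => [||i]; rewrite ?ltnS ?m0//.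
by rewrite tnth_stepV.
Qed.

(** The squared energy is c^2 m (n - m) / n = r^2 (1 - m / n). *)
Lemma energy_lb (n m : nat) (c r w : R) : (0 < m)%N -> (m < n)%N ->
  c ^+ 2 * m%:R = r ^+ 2 -> m%:R <= n%:R * w ->
  Num.sqrt (r ^+ 2 * (1 - w)) <= energy n m.+1 (0 - c).
Proof.
move=> m0 mn cr mw; have n0 : (0 : R) < n%:R by rewrite ltr0n (leq_trans _ mn).
rewrite /energy -sqrtr_sqr -sqrtrM ?sqr_ge0// sub0r sqrrN.
rewrite subn1 addn1 subSS natrM natrB ?(ltnW mn)//= mulrA mulrA cr -mulrA.
apply: ler_wsqrtr; rewrite ler_wpM2l ?sqr_ge0//.
rewrite ler_pdivlMr// mulrBl mul1r; lra.
Qed.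

End step_vectors.

(** Reduces the theorem to a numerical inequality, with [r ^+ 2 / p%:R ^+ 2] as [eps] and
    [r ^+ 2 / p%:R] as [delta]. *)
Lemma geometric_change_points_testing (R : realType) (n p K : nat) (r s sigma w : R)
    (T : n.-tuple R -> bool) :
  (0 < p)%N -> (0 < K)%N -> (p ^ (2 * K) < n)%N ->
  (p ^ (2 * K))%:R <= n%:R * w ->
  0 <= s -> s <= r -> 0 < r -> 0 < sigma ->
  expR (r ^+ 2 / 2 + r * s - s ^+ 2 / 2 + r ^+ 2 / p%:R ^+ 2) / K%:R +
    (expR (r ^+ 2 / p%:R) - 1) <= sigma ^+ 2 ->
  measurable_fun [set: n.-tuple R] T ->
  ((1 - expR (- s ^+ 2 / 2) - sigma)%:E <=
   ereal_sup [set law theta [set y | T y = true] | theta in @Theta0 R n] +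
   ereal_sup [set law theta [set y | T y = false] | theta in
     [set theta | @Theta1 R n theta /\
        (Num.sqrt (r ^+ 2 * (1 - w)) <= E1 theta)%R]])%E.
Proof.
move=> p0 K0 pKn pKw s0 sr r0 sigma0 hsigma mT.
have P0 : 0 < p%:R :> R by rewrite ltr0n.
have P1 : 1 <= p%:R :> R by rewrite ler1n.
pose c k : R := r / p%:R ^+ k.+1.
have c0 k : 0 < c k by rewrite divr_gt0// exprn_gt0.
pose m k := (p ^ (2 * k))%N.
have m_gt0 k : (0 < m k)%N by rewrite expn_gt0 p0.
have mE k : (m k)%:R = (p%:R ^+ k) ^+ 2 :> R by rewrite natrX mulnC exprM.
have m_homo j k : (j <= k)%N -> (m j <= m k)%N.
  by move=> jk; rewrite /m leq_pexp2l// leq_mul2l.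
have mn (k : 'I_K) : (m k.+1 < n)%N by apply: leq_ltn_trans pKn; exact: m_homo.
have cm k : c k ^+ 2 * (m k.+1)%:R = r ^+ 2.
  by rewrite mE /c exprMn exprVn mulfVK// expf_neq0// expf_neq0// gt_eqF.
pose theta (k : 'I_K) := stepV n 0 (m k.+1) (c k).
pose beta (k : 'I_K) := stepV n (m k) (m k.+1) (c k).
(* The removed initial segment is a fraction 1 / p^2 of the support of [theta k]. *)
have bb k : dotV (beta k) (beta k) = r ^+ 2 - r ^+ 2 / p%:R ^+ 2.
  rewrite dotV_stepV ?(ltnW (mn k))// natrB ?m_homo// mulrBl -expr2 mulrC cm.
  by congr (_ - _); rewrite mE /c (exprS _ k); field; rewrite expf_neq0 gt_eqF.
have corr (j k : 'I_K) : (j < k)%N -> dotV (theta j) (theta k) <= r ^+ 2 / p%:R.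
  move=> jk; rewrite (dotV_stepV _ _ (ltnW (mn j)) (leqnn 0)); last first.
    by apply: m_homo; rewrite ltnS ltnW.
  rewrite subn0 mE /c.
  (* This splitting isolates one factor [p]: the inner product is r^2 / (p q) with q = p^(k - j - 1)
     at least 1. *)
  have -> : k.+1 = (j.+1 + (k - j).-1.+1)%N.
    by rewrite prednK ?subn_gt0// addSn subnKC// ltnW.
  have Q : 1 <= p%:R ^+ (k - j).-1 :> R by rewrite exprn_ege1.
  rewrite exprD [p%:R ^+ (_).-1.+1]exprS.
  set a := p%:R ^+ j.+1; set q := p%:R ^+ _ in Q *.
  have a0 : a != 0 by rewrite expf_neq0// gt_eqF.
  have q0 : 0 < q by apply: lt_le_trans Q.
  have -> : a ^+ 2 * (r / a * (r / (a * (p%:R * q)))) = r ^+ 2 / p%:R / q.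
    by field; rewrite a0 !gt_eqF.
  by rewrite ler_pdivrMr// ler_peMr// divr_ge0 ?sqr_ge0// ltW.
have mA : measurable [set y | T y = true].
  rewrite -[[set y | _]]setTI; exact: (mT measurableT [set true]).
have AC : ~` [set y | T y = true] = [set y | T y = false].
  by apply/seteqP; split => y /=; case: (T y).
apply: (@le_trans _ _ (std_normal n [set y | T y = true] +
    \sum_(k < K) (K%:R^-1)%:E * law (theta k) (~` [set y | T y = true]))%E).
  apply: (gaussian_mixture_testing (r := r) (s := s) (beta := beta)
    (delta := r ^+ 2 / p%:R) (eps := r ^+ 2 / p%:R ^+ 2)) => //.
  - by rewrite divr_ge0 ?sqr_ge0// exprn_ge0.
  - by rewrite divr_ge0 ?sqr_ge0.
  - by move=> k i; apply: stepV_ge0; exact: ltW.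
  - by move=> k i; apply: stepV_ge0; exact: ltW.
  - move=> j k i jk; rewrite !tnth_stepV.
    wlog {jk} jk : j k / (j < k)%N => [W|].
      move: jk; rewrite neq_ltn => /orP[|] h; first exact: W.
      by rewrite mulrC; exact: W.
    case: ifP => [/andP[_ ij]|]; last by rewrite mul0r.
    by rewrite ifN ?mulr0// negb_and -ltnNge (leq_trans ij)// m_homo.
  - by move=> k; rewrite bb dotV_stepV// ?(ltnW (mn k))// -(bb k) dotV_stepV// ltnW.
  - by move=> k; rewrite bb.
  - by move=> k; rewrite bb lerBlDr lerDl divr_ge0 ?sqr_ge0// exprn_ge0.
  - by move=> k; rewrite dotV_stepV ?(ltnW (mn k))// subn0 mulrC -expr2 cm.
  - move=> j k; rewrite neq_ltn => /orP[|] h; first exact: corr.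
    by rewrite dotVC; exact: corr.
apply: leeD.
  (* [stepV n 0 0 0] is the null vector, whose law is [std_normal n]. *)
  apply: le_ereal_sup_tmp; exists (law (stepV n 0 0 0) [set y | T y = true]).
    exists (stepV n 0 0 0) => //; exists 0 => i.
    by rewrite tnth_stepV.
  rewrite /law/= /distribution/pushforward le_eqVlt; apply/orP; left; apply/eqP.
  congr (std_normal n _); apply/seteqP; split => y /=;
    rewrite (_ : addV _ y = y)//; apply: eq_from_tnth => i;
    by rewrite tnth_mktuple tnth_stepV add0r.
set S := ereal_sup _.
(* An average over the [theta k] is at most the supremum [S], as the weights sum to 1. *)
rewrite AC; apply: (@le_trans _ _ (\sum_(k < K) (K%:R^-1)%:E * S)%E).
  apply: lee_sum => k _; rewrite lee_wpmul2l ?lee_fin ?invr_ge0//.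
  apply: le_ereal_sup_tmp; exists (law (theta k) [set y | T y = false]) => //.
  exists (theta k) => //=.
  have cp := stepV_change_point (m_gt0 k.+1) (mn k) (lt0r_neq0 (c0 k)).
  split; first by exists (m k.+1).+1, (c k), 0.
  rewrite (E1E cp); apply: energy_lb => //.
  apply: le_trans pKw; rewrite ler_nat; exact: m_homo.
rewrite -ge0_sume_distrl; last by move=> k _; rewrite lee_fin invr_ge0.
rewrite sumEFin sumr_const card_ord -(mulr_natr K%:R^-1) mulVf ?mul1e//.
by rewrite pnatr_eq0 -lt0n.
Qed.

(** * Choice of the parameters *)

Section growth.
Context {R : realType}.

Lemma expR_ge_sqr (x : R) : 0 <= x -> x ^+ 2 / 2 <= expR x.
Proof.
by move=> x0; apply: le_trans (expR_ge1Dxn 1 x0); rewrite lerDr.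
Qed.

Lemma expR_le_sub1V (x : R) : x < 1 -> expR x <= (1 - x)^-1.
Proof.
move=> x1; rewrite -[x]opprK expRN opprK lef_pV2 ?posrE ?expR_gt0 ?subr_gt0//.
exact: expR_ge1Dx.
Qed.

(** With l = [ln L], p is at most L^2 = exp(2 l) and 8 l K at most L, whence p^(2 K) <= exp(4 l K)
    <= exp(L / 2). *)
Lemma geometric_scale (L : R) : 64 <= ln L -> 0 < L ->
  exists p K : nat, [/\ (0 < p)%N, (0 < K)%N, L <= p%:R,
    (p ^ (2 * K))%:R <= expR (L / 2) & K%:R^-1 <= 16 * ln L * expR (- ln L)].
Proof.
move=> l64 L0; set l := ln L in l64 *.
have LE : L = expR l by rewrite /l lnK.
have L16 : 16 * l <= L.
  rewrite LE; apply: le_trans (expR_ge_sqr _); last by lra.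
  by rewrite expr2; nra.
exists (Num.truncn L).+1, (Num.truncn (L / (8 * l))).
have l0 : 0 < l by lra.
have q0 : 0 <= L / (8 * l) by rewrite divr_ge0// ?ltW// mulr_gt0.
have /andP[K1 K2] := truncn_itv q0.
have /andP[p1 p2] := truncn_itv (ltW L0).
have q2 : 2 <= L / (8 * l) by rewrite ler_pdivlMr ?mulr_gt0//; lra.
set K := Num.truncn (L / (8 * l)) in K1 K2 *.
(* The integer part of a real at least 2 is at least half of it. *)
have Kh : L / (16 * l) <= K%:R.
  have -> : L / (16 * l) = L / (8 * l) / 2 by field; rewrite gt_eqF.
  by move: K2; rewrite -(natr1 K); lra.
have Lp : 0 < L / (16 * l) by rewrite divr_gt0// mulr_gt0.
have K0 : 0 < K%:R :> R by exact: lt_le_trans Kh.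
split => //.
- by rewrite -(ltr0n R).
- exact: ltW.
- have pe : (Num.truncn L).+1%:R <= expR (2 * l).
    rewrite -(natr1 (Num.truncn L)); apply: (@le_trans _ _ (L * L)).
      by have : 0 <= L * (L - 2) by [apply: mulr_ge0; lra]; rewrite mulrBr; lra.
    by rewrite mulrDl mul1r expRD -LE.
  rewrite natrX; apply: (@le_trans _ _ (expR (2 * l) ^+ (2 * K))).
    by rewrite lerXn2r// nnegrE ?expR_ge0.
  rewrite -expRM_natl ler_expR natrM.
  have : K%:R * (8 * l) <= L by rewrite -ler_pdivlMr ?mulr_gt0.
  lra.
- rewrite expRN -LE; apply: (@le_trans _ _ (L / (16 * l))^-1).
    by rewrite lef_pV2.
  by rewrite invf_div.
Qed.


(** Both the diagonal term and the correlation term are of order exp(- s^2); their constants 40000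
    and 8 add up to less than 300^2. *)
Lemma variance_bound (kappa l : R) :
  0 < kappa -> kappa < 2 / 3 -> 64 <= l -> 1 <= kappa ^+ 2 * l ->
  forall r s eps delta V : R, 0 <= r -> 0 <= s ->
  r ^+ 2 = 2 * (1 - kappa) * l ->
  s ^+ 2 = kappa ^+ 2 * l / (4 * (1 - kappa)) ->
  eps <= 1 / 2 -> delta <= 2 * l * expR (- l) -> 0 <= delta ->
  0 <= V -> V <= 16 * l * expR (- l) ->
  expR (r ^+ 2 / 2 + r * s - s ^+ 2 / 2 + eps) * V + (expR delta - 1)
    <= 300 ^+ 2 * expR (- s ^+ 2).
Proof.
move=> k0 k1 l64 kl r s eps delta V r0 s0 rE sE eps1 del1 del0 V0 V1.
have l0 : 0 < l by lra.
have a0 : 0 < 1 - kappa by lra.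
(* Equivalent to kappa <= 2 (1 - kappa), that is kappa <= 2 / 3. *)
have s2_ub : s ^+ 2 <= kappa * l / 2.
  rewrite sE ler_pdivrMr ?mulr_gt0//.
  have : 0 <= kappa * l * (2 * (1 - kappa) - kappa) by rewrite !mulr_ge0//; lra.
  by rewrite expr2; nra.
(* Exactly, r s = kappa l / sqrt 2, and 0.71 exceeds 1 / sqrt 2. *)
have rs_ub : r * s <= 71 / 100 * (kappa * l).
  rewrite -ler_sqr ?nnegrE ?mulr_ge0//; try lra.
  rewrite exprMn rE sE.
  have -> : 2 * (1 - kappa) * l * (kappa ^+ 2 * l / (4 * (1 - kappa))) =
    (kappa * l) ^+ 2 / 2 by field; lra.
  by rewrite [leRHS]exprMn; have := sqr_ge0 (kappa * l); lra.
have kl_ge0 : 0 <= kappa * l by rewrite mulr_ge0// ltW.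
have h1 : expR (r ^+ 2 / 2 + r * s - s ^+ 2 / 2 + eps) * V <=
    40 * 1000 * expR (- s ^+ 2).
  apply: (@le_trans _ _ (expR (r ^+ 2 / 2 + r * s - s ^+ 2 / 2 + eps) *
    (16 * l * expR (- l)))); first by rewrite ler_wpM2l ?expR_ge0.
  have -> : expR (r ^+ 2 / 2 + r * s - s ^+ 2 / 2 + eps) * (16 * l * expR (- l)) =
      16 * l * expR (r ^+ 2 / 2 + r * s - s ^+ 2 / 2 + eps - l).
    by rewrite [in RHS]expRD; ring.
  (* As r^2 / 2 - l = - kappa l, the exponent is - s^2 + eps + (s^2 / 2 + r s - kappa l), and the
     bracket is at most (1/4 + 71/100 - 1) kappa l = - kappa l / 25. *)
  have : expR (r ^+ 2 / 2 + r * s - s ^+ 2 / 2 + eps - l) <=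
      expR (- s ^+ 2) * (expR eps * expR (- (kappa * l / 25))).
    by rewrite -!expRD ler_expR rE; lra.
  have e2 : expR eps <= 2.
    apply: le_trans (expR_le_sub1V _) _; first lra.
    by rewrite invf_ple ?posrE//; lra.
  (* By exp(x) >= x^2 / 2 at x = kappa l / 25, with kappa^2 l >= 1. *)
  have h : l * expR (- (kappa * l / 25)) <= 1250.
    have x0 : 0 <= kappa * l / 25 by lra.
    rewrite expRN ler_pdivrMr ?expR_gt0//.
    have := expR_ge_sqr x0.
    have : 0 <= l * (kappa ^+ 2 * l - 1) by rewrite mulr_ge0 ?subr_ge0// ltW.
    by rewrite (_ : (kappa * l / 25) ^+ 2 / 2 = l * (kappa ^+ 2 * l) / 1250); [lra|field].
  have : 0 <= (2 - expR eps) * (l * expR (- (kappa * l / 25))).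
    by rewrite !mulr_ge0 ?subr_ge0 ?expR_ge0// ltW.
  move=> h3 h4.
  apply: (@le_trans _ _
      (16 * l * (expR (- s ^+ 2) * (expR eps * expR (- (kappa * l / 25)))))).
    by rewrite ler_wpM2l// mulr_ge0// ltW.
  rewrite (_ : 16 * l * _ = 16 *
      (expR eps * (l * expR (- (kappa * l / 25)))) * expR (- s ^+ 2)); last by ring.
  by rewrite ler_pM2r ?expR_gt0//; lra.
(* The chain is exp(delta) - 1 <= 2 delta <= 4 l exp(- l) <= 8 exp(- l / 2), and s^2 <= l / 2. *)
have h2 : expR delta - 1 <= 8 * expR (- s ^+ 2).
  have d12 : delta <= 1 / 2.
    apply: le_trans del1 _; rewrite expRN ler_pdivrMr ?expR_gt0//.
    have := expR_ge_sqr (ltW l0); nra.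
  have : expR delta - 1 <= 2 * delta.
    have := @expR_le_sub1V delta.
    have d1 : 0 < 1 - delta by lra.
    move=> /(_ ltac:(lra)).
    have : (1 - delta)^-1 <= 1 + 2 * delta.
      by rewrite -[leLHS]mul1r ler_pdivrMr//; nra.
    lra.
  have le2 : l / 2 <= expR (l / 2) by apply: le_trans (expR_ge1Dx _); lra.
  have : expR (- (l / 2)) <= expR (- s ^+ 2) by rewrite ler_expR; nra.
  have : l * expR (- l) <= 2 * expR (- (l / 2)).
    rewrite (_ : - l = - (l / 2) - l / 2); last by lra.
    rewrite expRD mulrA ler_wpM2r ?expR_ge0//.
    by rewrite expRN ler_pdivrMr ?expR_gt0//; lra.
  lra.
have := expR_ge0 (- s ^+ 2); rewrite expr2; lra.
Qed.

End growth.

Theorem proposition1 (R : realType) :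
  exists (c : R) (n0 : nat), 0 < c /\ (0 < n0)%N /\
    forall (kappa : R) (n : nat) (T : n.-tuple R -> bool),
      0 < kappa -> kappa < 2 / 3 -> (n0 <= n)%N ->
      measurable_fun [set: n.-tuple R] T ->
      ((1 - c * ln n%:R `^ (- (kappa ^+ 2 / (8 * (1 - kappa)))))%:E <=
       ereal_sup [set law theta [set y | T y = true] | theta in @Theta0 R n] +
       ereal_sup [set law theta [set y | T y = false] | theta in
         [set theta | @Theta1 R n theta /\
            (Num.sqrt (2 * (1 - kappa) * (1 - n%:R `^ (- (1 / 2))) *
                       ln (ln n%:R)) <= E1 theta)%R]])%E.
Proof.
(* The constant 301 is 300 for the standard deviation plus 1 for the truncated mass; the choice of
   [n0] ensures log log n >= 64. *)
exists 301, (Num.truncn (expR (expR 64 : R))).+1; split; first by rewrite ltr0n.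
split => [|kappa n T k0 k1 nn0 mT]; first exact: ltn0Sn.
have a0 : 0 < 1 - kappa by lra.
have nE : expR (expR 64) <= n%:R :> R.
  apply/ltW/(lt_le_trans (truncnS_gt _)); by rewrite ler_nat.
have n0 : 0 < n%:R :> R by apply: lt_le_trans nE; exact: expR_gt0.
set L := ln n%:R.
have nL : n%:R = expR L by rewrite /L lnK.
have L64 : expR 64 <= L by rewrite -ler_expR -nL.
have L0 : 0 < L by apply: lt_le_trans L64; exact: expR_gt0.
set l := ln L.
have LE : L = expR l by rewrite /l lnK.
have l64 : 64 <= l by rewrite -ler_expR -LE.
have l0 : 0 < l by lra.
pose s2 := kappa ^+ 2 * l / (4 * (1 - kappa)).
have s20 : 0 <= s2 by rewrite divr_ge0// ?mulr_ge0 ?sqr_ge0// ltW.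
have powE : L `^ (- (kappa ^+ 2 / (8 * (1 - kappa)))) = expR (- s2 / 2).
  rewrite /powR gt_eqF// -/l /s2; congr expR; field; lra.
rewrite powE.
pose r : R := Num.sqrt (2 * (1 - kappa) * l).
have r2 : r ^+ 2 = 2 * (1 - kappa) * l by rewrite sqr_sqrtr// !mulr_ge0// ltW.
have r0 : 0 < r by rewrite sqrtr_gt0 !mulr_gt0.
have -> : 2 * (1 - kappa) * (1 - n%:R `^ (- (1 / 2))) * l =
    r ^+ 2 * (1 - n%:R `^ (- (1 / 2))) by rewrite r2; ring.
have wE : n%:R * n%:R `^ (- (1 / 2)) = expR (L / 2).
  by rewrite /powR gt_eqF// -/L {1}nL -expRD; congr expR; field.
have [kl|kl] := leP 1 (kappa ^+ 2 * l); last first.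
  (* When kappa^2 l < 1 the lower bound to be proved is negative. *)
  have : 1 - 301 * expR (- s2 / 2) <= 0.
    have : s2 <= 3 / 4 by rewrite /s2 ler_pdivrMr; lra.
    have := expR_ge1Dx (- s2 / 2 : R); lra.
  (* The supremum of an empty set is [-oo], so nonnegativity requires a member of each class; for
     the alternative, a jump of size [r] after the first coordinate has enough energy. *)
  rewrite -lee_fin => /le_trans; apply; apply: adde_ge0.
    apply: le_ereal_sup_tmp; exists (law (stepV n 0 0 0) [set y | T y = true]) => //.
    exists (stepV n 0 0 0) => //; exists 0 => i.
    by rewrite tnth_stepV.
  have n1 : (1 < n)%N by rewrite -(ltr_nat R) nL -[X in X < _](@expR0 R) ltr_expR.
  have cp := stepV_change_point (ltn0Sn 0) n1 (lt0r_neq0 r0).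
  apply: le_ereal_sup_tmp; exists (law (stepV n 0 1 r) [set y | T y = false]) => //.
  exists (stepV n 0 1 r) => //; split; first by exists 2, r, 0.
  rewrite (E1E cp); apply: energy_lb => //; first by rewrite mulr1.
  by rewrite wE -[X in X <= _](@expR0 R) ler_expR divr_ge0// ltW.
have [p [K [p0 K0 Lp pK Kl]]] := geometric_scale l64 L0.
pose s : R := Num.sqrt s2.
have sE : s ^+ 2 = s2 by rewrite sqr_sqrtr.
have s0 : 0 <= s by exact: sqrtr_ge0.
(* This amounts to kappa^2 <= 8 (1 - kappa)^2, which holds for kappa < 2 / 3. *)
have sr : s <= r.
  rewrite ler_wsqrtr// /s2 ler_pdivrMr ?mulr_gt0//.
  have : 0 <= l * (8 * (1 - kappa) ^+ 2 - kappa ^+ 2).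
    by rewrite mulr_ge0 ?(ltW l0)//; nra.
  nra.
have pKn : (p ^ (2 * K) < n)%N.
  rewrite -(ltr_nat R); apply: le_lt_trans pK _; rewrite nL ltr_expR; lra.
have pKw : (p ^ (2 * K))%:R <= n%:R * n%:R `^ (- (1 / 2)) :> R by rewrite wE.
have p_gt0 : 0 < p%:R :> R by rewrite ltr0n.
(* The standard deviation is 300 exp(- s^2 / 2), of the same order as the truncated mass. *)
have hV : expR (r ^+ 2 / 2 + r * s - s ^+ 2 / 2 + r ^+ 2 / p%:R ^+ 2) / K%:R +
    (expR (r ^+ 2 / p%:R) - 1) <= (300 * expR (- s2 / 2)) ^+ 2.
  have -> : (300 * expR (- s2 / 2)) ^+ 2 = 300 ^+ 2 * expR (- s ^+ 2).
    by rewrite exprMn -expRM_natl sE; congr (_ * expR _); field.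
  have d0 : 0 <= r ^+ 2 / p%:R by rewrite divr_ge0 ?sqr_ge0// ltW.
  have dl : r ^+ 2 / p%:R <= 2 * l * expR (- l).
    rewrite expRN -LE; apply: ler_pM; rewrite ?sqr_ge0 ?invr_ge0 ?(ltW p_gt0)//.
      by rewrite r2; nra.
    by rewrite lef_pV2.
  apply: (variance_bound k0 k1 l64 kl (ltW r0) s0 r2 sE _ dl d0 _ Kl).
  - have P1 : 1 <= p%:R :> R by rewrite ler1n.
    apply: (@le_trans _ _ (r ^+ 2 / p%:R)).
      rewrite ler_wpM2l ?sqr_ge0// lef_pV2 ?posrE ?exprn_gt0// expr2; nra.
    apply: le_trans dl _; rewrite expRN ler_pdivrMr ?expR_gt0//.
    have := expR_ge_sqr (ltW l0); nra.
  - by rewrite invr_ge0.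
have sg0 : 0 < 300 * expR (- s2 / 2) by rewrite mulr_gt0 ?expR_gt0 ?ltr0n.
apply: le_trans (geometric_change_points_testing p0 K0 pKn pKw s0 sr r0 sg0 hV mT).
rewrite lee_fin sE; lra.
Qed.
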